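(* Let $f_S=1+X+Y+XY=(1+X)(1+Y)\in\mathbb{F}_2[X^{\pm1},Y^{\pm1}]$ and let $X_{f_S}$ be the 4-dot system, i.e. the set of all $c\in\mathbb{F}_2[[X^{\pm1},Y^{\pm1}]]$ with $f_Sc=0$. Then every low complexity $c\in X_{f_S}$ is periodic.
   Context: $\mathbb{F}_2[X^{\pm1},Y^{\pm1}]$ is the ring of Laurent polynomials over the two-element field, and $\mathbb{F}_2[[X^{\pm1},Y^{\pm1}]]$ is the set of formal two-sided power series $c=\sum_{(i,j)\in\mathbb{Z}^2}c_{i,j}X^iY^j$ (equivalently, configurations $c\in\mathbb{F}_2^{\mathbb{Z}^2}$), a module over the Laurent polynomial ring under the formal product. The translation by $\mathbf{t}\in\mathbb{Z}^2$ is $\tau_{\mathbf{t}}(c)_{\mathbf{n}}=c_{\mathbf{n}-\mathbf{t}}$. A configuration $c$ is periodic if $\tau_{\mathbf{t}}(c)=c$ for some non-zero $\mathbf{t}\in\mathbb{Z}^2$. For a finite $D\subset\mathbb{Z}^2$, $P(c,D)=\{\tau_{\mathbf{t}}(c)_{|D} : \mathbf{t}\in\mathbb{Z}^2\}$ is the set of $D$-patterns of $c$. The configuration $c$ has low complexity if $|P(c,D)|\le|D|$ for some finite $D\subset\mathbb{Z}^2$ (of any shape). *)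

(* Defs.v *)
From mathcomp Require Import all_boot all_order all_algebra.
From mathcomp Require Import finmap boolp.
From mathcomp Require Import xfinmap monalg.

Set Implicit Arguments.
Unset Strict Implicit.
Unset Printing Implicit Defensive.

Import GRing.Theory.
Local Open Scope fset_scope.
Local Open Scope ring_scope.

Notation Z2 := (int * int)%type.

Definition configuration : Type := Z2 -> 'F_2.

(* Finitely supported functions Z^2 -> F_2; the monomial X^i Y^j is << (i, j) >>.
   [monalg] provides a product on [{malg R[K]}] only for monoids K without
   non-trivial units, so the Laurent product is defined here. *)
Notation laurent := {malg 'F_2[Z2]}.

Definition laurent_monom (i j : int) : laurent := << (i, j) >>.

Definition laurent_mul (f g : laurent) : laurent :=
  \sum_(k <- msupp f) \sum_(l <- msupp g) << f@_k * g@_l *g (k + l) >>.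

Definition formal_mul (f : laurent) (c : configuration) : configuration :=
  fun n => \sum_(k <- msupp f) f@_k * c (n - k).

Definition f_S : laurent :=
  laurent_monom 0 0 + laurent_monom 1 0 + laurent_monom 0 1 + laurent_monom 1 1.

Definition annihilated_system (f : laurent) (c : configuration) : Prop :=
  formal_mul f c =1 (fun=> 0).

Definition translation (t : Z2) (c : configuration) : configuration :=
  fun n => c (n - t).

Definition periodic (c : configuration) : Prop :=
  exists2 t : Z2, t != 0 & translation t c =1 c.

Definition restriction (D : {fset Z2}) (c : configuration) : {ffun D -> 'F_2} :=
  [ffun d : D => c (val d)].

Definition patterns (c : configuration) (D : {fset Z2}) :
    {set {ffun D -> 'F_2}} :=
  [set p | `[< exists t : Z2, p = restriction D (translation t c) >]].

Definition low_complexity (c : configuration) : Prop :=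
  exists D : {fset Z2}, (#|patterns c D| <= #|` D|)%N.

Lemma formal_mulEw (f : laurent) (c : configuration) (D : {fset Z2}) n :
  msupp f `<=` D -> formal_mul f c n = \sum_(k <- D) f@_k * c (n - k).
Proof.
move=> sfD; rewrite /formal_mul; apply: big_fset_incl => // k _ kf.
by rewrite mcoeff_outdom // mul0r.
Qed.

Lemma formal_mulD (f g : laurent) (c : configuration) n :
  formal_mul (f + g) c n = formal_mul f c n + formal_mul g c n.
Proof.
pose D := msupp f `|` msupp g.
rewrite !(@formal_mulEw _ _ D) ?fsubsetUl ?fsubsetUr ?msuppD_le //.
by rewrite -big_split; apply: eq_bigr => k _; rewrite /= mcoeffD mulrDl.
Qed.

Lemma formal_mul_monom i j (c : configuration) n :
  formal_mul (laurent_monom i j) c n = c (n - (i, j)).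
Proof.
rewrite (@formal_mulEw _ _ [fset (i, j)]) ?msuppU_le //.
by rewrite big_seq_fset1 mcoeffUU mul1r.
Qed.

Lemma formal_mul_f_S (c : configuration) n :
  formal_mul f_S c n =
    c n + c (n - (1, 0)) + c (n - (0, 1)) + c (n - (1, 1)).
Proof. by rewrite !formal_mulD !formal_mul_monom subr0. Qed.

Lemma laurent_mulEw (f g : laurent) (D E : {fset Z2}) :
  msupp f `<=` D -> msupp g `<=` E ->
  laurent_mul f g =
    \sum_(k <- D) \sum_(l <- E) << f@_k * g@_l *g (k + l) >>.
Proof.
move=> sfD sgE; rewrite /laurent_mul (big_fset_incl _ sfD) => [|k _ kf]; last first.
  by apply: big1 => l _; rewrite mcoeff_outdom // mul0r monalgU0.
apply: eq_bigr => k _; apply: big_fset_incl => // l _ lg.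
by rewrite [g@_l]mcoeff_outdom // mulr0 monalgU0.
Qed.

Lemma laurent_mulDl (f1 f2 g : laurent) :
  laurent_mul (f1 + f2) g = laurent_mul f1 g + laurent_mul f2 g.
Proof.
pose D := msupp f1 `|` msupp f2.
rewrite !(@laurent_mulEw _ g D (msupp g)) ?fsubsetUl ?fsubsetUr ?msuppD_le //.
rewrite -big_split; apply: eq_bigr => k _; rewrite /= -big_split.
by apply: eq_bigr => l _; rewrite /= mcoeffD mulrDl monalgUD.
Qed.

Lemma laurent_mulDr (f g1 g2 : laurent) :
  laurent_mul f (g1 + g2) = laurent_mul f g1 + laurent_mul f g2.
Proof.
pose E := msupp g1 `|` msupp g2.
rewrite !(@laurent_mulEw f _ (msupp f) E) ?fsubsetUl ?fsubsetUr ?msuppD_le //.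
rewrite -big_split; apply: eq_bigr => k _; rewrite /= -big_split.
by apply: eq_bigr => l _; rewrite /= mcoeffD mulrDr monalgUD.
Qed.

Lemma laurent_mul_monom i j k l :
  laurent_mul (laurent_monom i j) (laurent_monom k l) =
    laurent_monom (i + k) (j + l).
Proof.
rewrite (@laurent_mulEw _ _ [fset (i, j)] [fset (k, l)]) ?msuppU_le //.
by rewrite !big_seq_fset1 !mcoeffUU mulr1.
Qed.

Lemma f_S_factor :
  f_S = laurent_mul (laurent_monom 0 0 + laurent_monom 1 0)
                    (laurent_monom 0 0 + laurent_monom 0 1).
Proof.
by rewrite laurent_mulDr !laurent_mulDl !laurent_mul_monom !addr0 !add0r !addrA.
Qed.

(* Main.v *)
Require Import Defs.
From mathcomp Require Import all_boot all_order all_algebra.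
From mathcomp Require Import finmap boolp zify.

(** A configuration annihilated by (1 + X)(1 + Y) has the form
    c (i, j) = a i + b j.  Read in the signs +1, -1, the sum becomes the product
    alpha i * beta j over the rationals.  If c has at most |D| patterns of shape
    D, the patterns extended by a constant coordinate 1 do not span Q^(1 + |D|),
    so some nontrivial rational combination of the translates of
    alpha (x) beta by D is constant.  A sequence over a finite alphabet
    satisfying a nontrivial affine recurrence is periodic, by the pigeonhole
    principle.  So if a is not periodic, the combination vanishes column by
    column, and each nonzero column is a recurrence for b. *)

Set Implicit Arguments.
Unset Strict Implicit.
Unset Printing Implicit Defensive.

Import Order.TTheory GRing.Theory Num.Theory.
Local Open Scope ring_scope.

Lemma int_shift_ind (P : int -> Prop) (x0 : int) :
  P x0 -> (forall x, P x -> P (x + 1)) -> (forall x, P x -> P (x - 1)) ->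
  forall x, P x.
Proof.
move=> P0 PS PP x; rewrite -[x](subrK x0) addrC.
elim: (x - x0) => [|n IHn|n IHn]; first by rewrite addr0.
  by rewrite -addn1 PoszD addrA; apply: PS.
by rewrite -addn1 PoszD opprD addrA; apply: PP.
Qed.

Lemma shift_invariant_const (T : Type) (f : int -> T) :
  (forall x, f x = f (x - 1)) -> forall x, f x = f 0.
Proof.
move=> fS; apply: (@int_shift_ind (fun x => f x = f 0) 0) => // x <-.
  by rewrite fS addrK.
by rewrite -fS.
Qed.

Definition seq_periodic (T : Type) (a : int -> T) : Prop :=
  exists2 p : int, p != 0 & forall x, a (x + p) = a x.

Section AffineRecurrence.

Variables (T : finType) (R : fieldType) (phi : T -> R) (a : int -> T).
Hypothesis phi_inj : injective phi.

(** Pigeonhole: among the starting points [0, ..., #|{ffun 'I_m -> T}|], two carry the same word of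
    length [m]. *)
Lemma equal_windows (m : nat) :
  exists s p : int,
    p != 0 /\ (forall k, (k < m)%N -> a (s + k%:Z) = a (s + p + k%:Z)).
Proof.
pose W (x : 'I_(#|{ffun 'I_m -> T}|.+1)) : {ffun 'I_m -> T} :=
  [ffun k : 'I_m => a (x%:Z + k%:Z)].
have [/injectiveP injW|/injectivePn[x [y neq_xy eqW]]] := boolP (injectiveb W).
  by have := leq_card W injW; rewrite card_ord ltnn.
exists x%:Z, (y%:Z - x%:Z); split=> [|k ltkm].
  by rewrite subr_eq0; apply: contraNneq neq_xy => -[/val_inj->].
have := congr1 (fun g : {ffun 'I_m -> T} => g (Ordinal ltkm)) eqW.
by rewrite !ffunE /= [x%:Z + (_ - _)]addrC subrK.
Qed.

(** Since both end coefficients are nonzero and [phi] is injective, [n] consecutive letters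
    determine the next letter on either side. The equality of two windows at distance [p] thus
    propagates to all of Z. *)
Lemma reversible_recurrence_periodic (n : nat) (h : nat -> R) (b : R) :
  (forall s : int, \sum_(k < n.+1) h k * phi (a (s + k%:Z)) = b) ->
  h 0%N != 0 -> h n != 0 -> seq_periodic a.
Proof.
move=> rec_a h0 hn; have [s [p [p0 eq_s]]] := equal_windows n.
pose E (x : int) := forall k, (k < n)%N -> a (x + k%:Z) = a (x + p + k%:Z).
have last_eq x : E x -> a (x + n%:Z) = a (x + p + n%:Z).
  move=> Ex; have := rec_a x; rewrite -(rec_a (x + p)) !big_ord_recr /=.
  under eq_bigr => k _ do rewrite Ex //.
  by move/addrI/(mulfI hn)/phi_inj.
have first_eq x : E (x + 1) -> a x = a (x + p).
  move=> Ex; have := rec_a x; rewrite -(rec_a (x + p)) !big_ord_recl /=.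
  have shift y (k : nat) : y + (bump 0 k)%:Z = y + 1 + k%:Z :> int.
    by rewrite /bump; lia.
  under eq_bigr => k _ do rewrite shift Ex //.
  under [in RHS]eq_bigr => k _ do rewrite shift.
  rewrite [x + 1 + p]addrAC !addr0.
  by move/addIr/(mulfI h0)/phi_inj.
have allE x : E x.
  apply: (@int_shift_ind E s) => // {}x Ex k ltkn.
    have [ltkn1|] := ltnP k.+1 n.
      have := Ex _ ltkn1; congr (a _ = a _); lia.
    move=> lenk; have := last_eq _ Ex; congr (a _ = a _); lia.
  case: k ltkn => [|k] ltkn.
    by rewrite !addr0; apply: first_eq; rewrite subrK.
  have := Ex _ (ltnW ltkn); congr (a _ = a _); lia.
by exists p => // x; apply/esym/first_eq/allE.
Qed.

Lemma recurrence_periodic (n : nat) (h : nat -> R) (b : R) :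
  (forall s : int, \sum_(k < n) h k * phi (a (s + k%:Z)) = b) ->
  (exists2 k, (k < n)%N & h k != 0) -> seq_periodic a.
Proof.
elim: n h => [|n IHn] h rec_a [k ltkn hk] //.
have [hn0|hn] := eqVneq (h n) 0.
  apply: (IHn h) => [s|].
    by rewrite -(rec_a s) big_ord_recr /= hn0 mul0r addr0.
  exists k => //; move: ltkn; rewrite ltnS leq_eqVlt.
  by case: eqP => // eq_kn; rewrite eq_kn hn0 eqxx in hk.
have [h00|h0] := eqVneq (h 0%N) 0; last exact: reversible_recurrence_periodic rec_a _ _.
(* Dropping a zero first coefficient moves the window by one, hence the instance at [s - 1]. *)
apply: (IHn (h \o succn)) => [s|].
  rewrite -(rec_a (s - 1)) big_ord_recl /= h00 mul0r add0r.
  by apply: eq_bigr => i _; congr (_ * phi (a _)); rewrite /bump /=; lia.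
by case: k ltkn hk => [|k] ltkn hk; [rewrite h00 eqxx in hk | exists k].
Qed.

(** The offsets [x i] may repeat, so the coefficient of the recurrence at [z] is the total weight of
    the fibre over [z]; a nonzero one would make [a] periodic. *)
Lemma nonperiodic_recurrence_trivial
    (I : finType) (x : I -> int) (w : I -> R) (b : R) :
  ~ seq_periodic a ->
  (forall s : int, \sum_i w i * phi (a (x i + s)) = b) ->
  forall z : int, \sum_(i | x i == z) w i = 0.
Proof.
move=> aperN rec_a z; apply/eqP/negP => /negP hz; apply: aperN.
(* [N] bounds [z] and all offsets in absolute value, so adding [N] brings them into the range from 0
   to [N + N]. *)
pose N := (`|z| + \sum_i `|x i|)%N.
have leN i : (`|x i| <= N)%N by rewrite /N (bigD1 i) //=; lia.
pose h k := \sum_(i | x i == k%:Z - N%:Z) w i.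
apply: (@recurrence_periodic (N + N).+1 h b) => [s|]; last first.
  exists (absz (z + N%:Z)); first by rewrite /N; lia.
  have eq_z : (absz (z + N%:Z))%:Z - N%:Z = z by rewrite /N; lia.
  by rewrite /h eq_z.
rewrite -(rec_a (s + N%:Z)).
under eq_bigr => k _ do rewrite /h mulr_suml big_mkcond.
rewrite exchange_big; apply: eq_bigr => i _; rewrite -big_mkcond /=.
have lti : (absz (x i + N%:Z)%R < (N + N).+1)%N by have := leN i; lia.
rewrite (big_pred1 (Ordinal lti)) => [|k] /=.
  by congr (_ * phi (a _)); have := leN i; lia.
by rewrite -val_eqE /=; have := leN i; lia.
Qed.

End AffineRecurrence.

Definition sign_char (x : 'F_2) : rat := if x == 0 then 1 else -1.

Lemma sign_charD x y : sign_char (x + y) = sign_char x * sign_char y.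
Proof. by case: x y => [[|[|//]] ?] [[|[|//]] ?]. Qed.

Lemma sign_char_inj : injective sign_char.
Proof.
by case=> [[|[|//]] ?] [[|[|//]] ?] //= _; apply/val_inj.
Qed.

Lemma pair_subE (i j k l : int) : (i, j) - (k, l) = (i - k, j - l) :> Z2.
Proof. by []. Qed.

Lemma pair_addE (i j k l : int) : (i, j) + (k, l) = (i + k, j + l) :> Z2.
Proof. by []. Qed.

Lemma four_dot_decomposition (c : configuration) :
  annihilated_system f_S c ->
  exists a b : int -> 'F_2, forall i j, c (i, j) = a i + b j.
Proof.
move=> cS; exists (fun i => c (i, 0)), (fun j => c (0, j) - c (0, 0)).
have char2 (u v : 'F_2) : u + v = 0 -> u = v.
  by move/eqP; rewrite addr_eq0 (oppr_pchar2 (pchar_Fp _)) // => /eqP.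
have dot i j : c (i, j) - c (i, j - 1) = c (i - 1, j) - c (i - 1, j - 1).
  have := cS (i, j); rewrite formal_mul_f_S !(oppr_pchar2 (pchar_Fp _)) //.
  rewrite !pair_subE !subr0 => sum0; apply: char2.
  by rewrite -sum0 -!addrA; congr (_ + _); rewrite addrCA.
(* Vertical differences do not depend on the column; telescoping them makes [c (i, j) - c (0, j)]
   independent of [j]. *)
have row i j : c (i, j) - c (i, j - 1) = c (0, j) - c (0, j - 1).
  exact: (@shift_invariant_const _ (fun i => c (i, j) - c (i, j - 1))).
have col i j : c (i, j) - c (0, j) = c (i, 0) - c (0, 0).
  apply: (@shift_invariant_const _ (fun j => c (i, j) - c (0, j))) => {}j.
  by apply/eqP; rewrite subr_eq -addrA [- _ + _]addrC -(row i) addrC subrK.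
by move=> i j; rewrite addrCA -(col i j) addrC subrK.
Qed.

Lemma constant_translate_combination (c : configuration) (D : {fset Z2}) :
  (#|patterns c D| <= #|` D|)%N ->
  exists (w : D -> rat) (b : rat),
    (exists d, w d != 0) /\
    forall t : Z2, \sum_d w d * sign_char (c (val d + t)) = b.
Proof.
rewrite cardfE => low.
(* One column per pattern, under a row of ones that accounts for the constant. There are more rows
   than columns, so the left kernel is nonzero. *)
pose M : 'M[rat]_(1 + #|{: D}|, #|patterns c D|) :=
  col_mx (const_mx 1)
         (\matrix_(i, j) sign_char ((enum_val j : {ffun D -> 'F_2}) (enum_val i))).
have /rowV0Pn[v /sub_kermxP vM v0] : kermx M != 0.
  rewrite kermx_eq0 /row_free neq_ltn.
  by rewrite (leq_ltn_trans (rank_leq_col M)) // add1n ltnS.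
rewrite -[v]hsubmxK mul_row_col in vM.
pose w (d : D) := rsubmx v 0 (enum_rank d).
have wP t : \sum_d w d * sign_char (c (val d + t)) = - lsubmx v 0 0.
  pose p := restriction D (translation (- t) c).
  have pP : p \in patterns c D by rewrite inE; apply/asboolP; exists (- t).
  have := congr1 (fun A : 'rV_ _ => A 0 (enum_rank_in pP p)) vM.
  rewrite !mxE big_ord1 !mxE mulr1 => /eqP.
  rewrite addrC addr_eq0 => /eqP; apply: etrans.
  rewrite [RHS](reindex (@enum_rank D)) /=; last exact/onW_bij/enum_rank_bij.
  apply: eq_bigr => d _; rewrite !mxE enum_rankK enum_rankK_in //.
  by rewrite /w /p ffunE /translation opprK mxE.
exists w, (- lsubmx v 0 0); split=> //.
(* If all of [w] vanished, so would the constant, and with it the kernel vector [v]. *)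
apply: contrapT => /forallNP w0.
have {}w0 d : w d = 0 by apply/eqP/negP => /negP/w0.
have r0 : rsubmx v = 0.
  by apply/rowP=> i; rewrite [RHS]mxE -[i]enum_valK; apply: w0.
have l0 : lsubmx v = 0.
  apply/rowP=> i; rewrite ord1 [RHS]mxE; apply/oppr_inj.
  by rewrite -(wP 0) oppr0 big1 // => d _; rewrite w0 mul0r.
by case/eqP: v0; rewrite -[v]hsubmxK l0 r0 row_mx0.
Qed.

Theorem theorem10 (c : configuration) :
  annihilated_system f_S c -> low_complexity c -> periodic c.
Proof.
move=> /four_dot_decomposition[a [b cE]] [D /constant_translate_combination].
move=> [w [e [[d0 wd0] wE]]].
have [[p p0 aE]|aperN] := pselect (seq_periodic a).
  exists (p, 0) => [|[i j]]; first by apply: contraNneq p0 => -[->].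
  by rewrite /translation pair_subE subr0 !cE -(aE (i - p)) subrK.
have [[p p0 bE]|bperN] := pselect (seq_periodic b).
  exists (0, p) => [|[i j]]; first by apply: contraNneq p0 => -[->].
  by rewrite /translation pair_subE subr0 !cE -(bE (j - p)) subrK.
(* With [t] fixed, the relation is an affine recurrence for [a] whose weights contain the signs of
   [b]. *)
have col0 z t : \sum_(d : D | (val d).1 == z) w d * sign_char (b ((val d).2 + t)) = 0.
  apply: (nonperiodic_recurrence_trivial sign_char_inj aperN (b := e)) => s.
  rewrite -(wE (s, t)); apply: eq_bigr => d _; rewrite -mulrA; congr (_ * _).
  by case: (val d) => i j; rewrite pair_addE cE sign_charD mulrC.
(* In the column of [d0], the vanishing sum is a recurrence for [b]. Its coefficient at the height
   of [d0] is [w d0] alone, which is nonzero. *)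
pose w1 d := if (val d).1 == (val d0).1 then w d else 0.
have : \sum_(d : D | (val d).2 == (val d0).2) w1 d = 0.
  apply: (nonperiodic_recurrence_trivial sign_char_inj bperN (b := 0)) => t.
  apply: etrans (col0 (val d0).1 t); rewrite [RHS]big_mkcond.
  apply: eq_bigr => d _ /=.
  by rewrite /w1; case: ifP; rewrite ?mul0r.
rewrite (bigD1 d0) //= big1 => [|d /andP[/eqP eq2 neq_d]].
  by rewrite /w1 eqxx addr0 => w0; rewrite w0 eqxx in wd0.
rewrite /w1; case: eqP => // eq1; case/eqP: neq_d; apply/val_inj/eqP/andP.
by split; apply/eqP.
Qed.
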